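(* Fix $t\in\{0,1,\dots,T-1\}$, a risk-aversion vector $\beta$ and a spot price $p\in\mathbb R$. Let $r_{t,T}(p\,|\,\beta)$ denote the smallest $\tilde r\in\mathcal R$ minimizing $\tilde r\,p+\tilde V_{t,T}(\tilde r,p\,|\,\beta)$ over $\tilde r\in\mathcal R$. Then for every $r\in\mathcal R$, the decision $$x_{t,T}(r,p\,|\,\beta)=\min\{r_{t,T}(p\,|\,\beta)-r,\;x_{\max}\}\,\mathbf 1\{r\le r_{t,T}(p\,|\,\beta)\}$$ belongs to $\mathcal X(r)$ and attains the minimum in $V_{t,T}(r,p\,|\,\beta)=\min_{x\in\mathcal X(r)}\{xp-c_f+\tilde V_{t,T}(r+x,p\,|\,\beta)\}$.
   Context: Model (dynamic EV charging). Fix a horizon $T\in\{1,2,\dots\}$, a battery capacity $R_{\max}>0$, a maximal charge per period $x_{\max}>0$, an initial charge $R_0\in[0,R_{\max}]$, an access fee $c_f\in\mathbb R$, a reference price $p_{\mathrm{ref}}>0$, a constant $\gamma_h\ge 0$, a deterministic seasonality function $g:\mathbb R\to\mathbb R$, and price parameters $\kappa_Y>0$, $\mu_Y\in\mathbb R$, $\sigma_Y>0$, $\lambda_J\in(0,1)$, $\mu_J\in\mathbb R$, $\sigma_J>0$. Spot prices are $P_t=g(t)+Y_t$ with $Y_{t+1}=Y_te^{-\kappa_Y}+\mu_Y(1-e^{-\kappa_Y})+\xi_{t+1}+X_{t+1}J_{t+1}$, where $(\xi_t)$ are i.i.d. $\mathcal N\big(0,\sigma_Y^2(1-e^{-2\kappa_Y})/(2\kappa_Y)\big)$,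 $(X_t)$ are i.i.d. Bernoulli$(\lambda_J)$, $(J_t)$ are i.i.d. $\mathcal N(\mu_J,\sigma_J^2)$, all mutually independent. Define $\psi_{t+1}=g(t+1)-g(t)e^{-\kappa_Y}+\mu_Y(1-e^{-\kappa_Y})+\xi_{t+1}+X_{t+1}J_{t+1}$ and $\psi_{t+1,Y}=\psi_{t+1}-g(t+1)$ (so given $P_t=p$, $P_{t+1}$ has the law of $pe^{-\kappa_Y}+\psi_{t+1}$ and $Y_{t+1}$ that of $pe^{-\kappa_Y}+\psi_{t+1,Y}$). Let $\mathcal R=[0,R_{\max}]$, $\mathcal X(r)=[0,\min\{R_{\max}-r,x_{\max}\}]$, and shortage $h(r)=\min\{R_0+Tx_{\max},R_{\max}\}-r$. Let $\gamma_Y:\mathbb R\to(0,\infty)$ be a continuous compensation function. Risk measures. For $\alpha\in(0,1)$: $\mathrm{VaR}_\alpha(X)=\inf\{u:\mathbf P(X\le u)>\alpha\}$, $\mathrm{CVaR}_\alpha(X)=\inf_u\{u+(1-\alpha)^{-1}\mathbf E[(X-u)^+]\}$. For $\beta_t=(\lambda_t,\alpha_t)\in[0,1]\times(0,1)$, $\rho_{\beta_t}(X)=(1-\lambda_t)\mathbf E[X]+\lambda_t\mathrm{CVaR}_{\alpha_t}(X)$. A risk-aversion vector is $\beta=(\lambda_0,\alpha_0,\dots,\lambda_T,\alpha_T)$. Value functions. For $r\in\mathcal R$, $p\in\mathbb R$: $V_{T,T}(r,p\,|\,\beta)=\rho_{\beta_T}\big[\big(1+\gamma_h h(r)+\gamma_Y(pe^{-\kappa_Y}+\psi_{T+1,Y})\big)h(r)p_{\mathrm{ref}}\big]$,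 and for $t=T-1,\dots,0$: $\tilde V_{t,T}(r,p\,|\,\beta)=\rho_{\beta_t}\big[V_{t+1,T}(r,pe^{-\kappa_Y}+\psi_{t+1}\,|\,\beta)\big]$ (post-decision value function) and $V_{t,T}(r,p\,|\,\beta)=\min_{x\in\mathcal X(r)}\{xp-c_f+\tilde V_{t,T}(r+x,p\,|\,\beta)\}$.
   Formalization: It is additionally assumed that all expectations in the recursion from T down to t exist (each integrand is absolutely integrable for all charge levels and prices); for a fast-growing compensation function γ_Y they are infinite and the smallest minimizer can be undefined. *)

(* Defs.v *)
From Stdlib Require Import Reals Lra ClassicalEpsilon.
Open Scope R_scope.

Record Model := mkModel {
  T : nat;
  Rcap : R;
  xmax : R;
  R0 : R;
  cf : R;             (* access fee c_f *)
  pref : R;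
  gam_h : R;
  g : R -> R;         (* seasonality *)
  kY : R; muY : R; sY : R;
  lamJ : R; muJ : R; sJ : R;
  gamY : R -> R       (* compensation function gamma_Y *)
}.

Definition model_ok (M : Model) : Prop :=
  (1 <= T M)%nat /\ 0 < Rcap M /\ 0 < xmax M /\ 0 <= R0 M <= Rcap M /\
  0 < pref M /\ 0 <= gam_h M /\ 0 < kY M /\ 0 < sY M /\
  0 < lamJ M < 1 /\ 0 < sJ M /\
  continuity (gamY M) /\ (forall y, 0 < gamY M y).

(** Risk-aversion vector: beta s = (lambda_s, alpha_s), s = 0..T. *)
Definition beta_ok (M : Model) (beta : nat -> R * R) : Prop :=
  forall s, (s <= T M)%nat ->
    0 <= fst (beta s) <= 1 /\ 0 < snd (beta s) < 1.

Definition npdf (m v x : R) : R :=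
  exp (- (x - m) ^ 2 / (2 * v)) / sqrt (2 * PI * v).

Definition xi_var (M : Model) : R :=
  sY M ^ 2 * (1 - exp (-2 * kY M)) / (2 * kY M).

(** Density of psi_{t+1} = g(t+1) - g(t) e^{-kY} + muY (1 - e^{-kY}) + xi_{t+1} + X_{t+1} J_{t+1}:
    a two-component Gaussian mixture. *)
Definition psi_const (M : Model) (t : nat) : R :=
  g M (INR (t + 1)) - g M (INR t) * exp (- kY M) + muY M * (1 - exp (- kY M)).

Definition psi_dens (M : Model) (t : nat) (x : R) : R :=
  (1 - lamJ M) * npdf (psi_const M t) (xi_var M) x +
  lamJ M * npdf (psi_const M t + muJ M) (xi_var M + sJ M ^ 2) x.

Definition improper_integral (f : R -> R) (l : R) : Prop :=
  forall eps, 0 < eps -> exists M0, 0 <= M0 /\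
    forall a b, a <= - M0 -> M0 <= b ->
      exists pr : Riemann_integrable f a b, Rabs (RiemannInt pr - l) < eps.

Definition integrable_wrt (dens f : R -> R) : Prop :=
  (forall a b, inhabited (Riemann_integrable (fun x => f x * dens x) a b)) /\
  exists l, improper_integral (fun x => Rabs (f x * dens x)) l.

Definition expect (dens f : R -> R) : R :=
  epsilon (inhabits 0) (fun l => improper_integral (fun x => f x * dens x) l).

Definition is_inf (S : R -> Prop) (m : R) : Prop :=
  (forall y, S y -> m <= y) /\ (forall m', (forall y, S y -> m' <= y) -> m' <= m).

Definition Rinf (S : R -> Prop) : R := epsilon (inhabits 0) (is_inf S).

Definition CVaR (dens : R -> R) (alpha : R) (X : R -> R) : R :=
  Rinf (fun y => exists u,
          y = u + / (1 - alpha) * expect dens (fun w => Rmax (X w - u) 0)).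

Definition rho (dens : R -> R) (b : R * R) (X : R -> R) : R :=
  (1 - fst b) * expect dens X + fst b * CVaR dens (snd b) X.

Definition hshort (M : Model) (r : R) : R :=
  Rmin (R0 M + INR (T M) * xmax M) (Rcap M) - r.

Definition Xadm (M : Model) (r x : R) : Prop :=
  0 <= x <= Rmin (Rcap M - r) (xmax M).

(** Terminal random cost, as a function of the realisation w of psi_{T+1}
    (psi_{T+1,Y} = psi_{T+1} - g(T+1)). *)
Definition term_cost (M : Model) (r p w : R) : R :=
  (1 + gam_h M * hshort M r
     + gamY M (p * exp (- kY M) + w - g M (INR (T M + 1))))
  * hshort M r * pref M.

Definition Vtil_gen (M : Model) (beta : nat -> R * R) (t : nat)
  (Vnext : R -> R -> R) (r p : R) : R :=
  rho (psi_dens M t) (beta t) (fun w => Vnext r (p * exp (- kY M) + w)).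

(** Vn n = V_{T-n,T}. *)
Fixpoint Vn (M : Model) (beta : nat -> R * R) (n : nat) : R -> R -> R :=
  match n with
  | O => fun r p => rho (psi_dens M (T M)) (beta (T M)) (term_cost M r p)
  | S k => fun r p =>
      Rinf (fun y => exists x, Xadm M r x /\
              y = x * p - cf M + Vtil_gen M beta (T M - S k) (Vn M beta k) (r + x) p)
  end.

Definition V (M : Model) (beta : nat -> R * R) (t : nat) : R -> R -> R :=
  Vn M beta (T M - t).

Definition Vtil (M : Model) (beta : nat -> R * R) (t : nat) : R -> R -> R :=
  Vtil_gen M beta t (V M beta (t + 1)).

(** All expectations occurring in the backward recursion from T down to t
    are finite (integrability), so that the value functions are well defined. *)
Definition well_posed (M : Model) (beta : nat -> R * R) (t : nat) : Prop :=
  (forall r p, 0 <= r <= Rcap M ->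
     integrable_wrt (psi_dens M (T M)) (term_cost M r p)) /\
  (forall s r p, (t <= s < T M)%nat -> 0 <= r <= Rcap M ->
     integrable_wrt (psi_dens M s)
       (fun w => V M beta (s + 1) r (p * exp (- kY M) + w))).

Definition smallest_minimizer (M : Model) (beta : nat -> R * R) (t : nat)
  (p rs : R) : Prop :=
  0 <= rs <= Rcap M /\
  (forall r', 0 <= r' <= Rcap M ->
     rs * p + Vtil M beta t rs p <= r' * p + Vtil M beta t r' p) /\
  (forall r', 0 <= r' <= Rcap M ->
     r' * p + Vtil M beta t r' p <= rs * p + Vtil M beta t rs p -> rs <= r').

Definition xdec (M : Model) (rs r : R) : R :=
  if Rle_dec r rs then Rmin (rs - r) (xmax M) else 0.

(* Main.v *)
Require Import Defs.
From Stdlib Require Import Reals Lra Lia ClassicalEpsilon.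
From Stdlib Require Import FunctionalExtensionality PropExtensionality.
From Coquelicot Require Import Coquelicot.
Open Scope R_scope.

(** The value functions are convex in the charge level [r]: the terminal cost is a
    convex quadratic in [r], the risk measures are monotone and convex, and
    minimising the jointly convex [x * p + Vtil (r + x) p] over [x] keeps convexity
    (the minimum is finite since a convex function on a compact interval is bounded
    below).  Hence [r' * p + Vtil r' p] is convex in [r'], so it does not increase
    when [r'] moves towards its minimizer [rs], and the best admissible decision is
    to come as close to [rs] as possible.

    Of the Gaussian mixture density only finiteness of its total mass is used. *)

(** * Improper integrals *)

(** Trades the integrability proof carried by [RiemannInt] for the predicate [ex_RInt] and the total
    function [RInt]. *)
Lemma improper_integralE (f : R -> R) (l : R) :
  improper_integral f l <->
  forall eps, 0 < eps -> exists N, 0 <= N /\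
    forall a b, a <= - N -> N <= b ->
      ex_RInt f a b /\ Rabs (RInt f a b - l) < eps.
Proof.
  split; intros H eps Heps; destruct (H eps Heps) as [N [HN HI]];
    exists N; split; auto; intros a b Ha Hb.
  - destruct (HI a b Ha Hb) as [pr Hpr].
    rewrite (RInt_Reals f a b pr). split; auto.
    now apply ex_RInt_Reals_1.
  - destruct (HI a b Ha Hb) as [ex Hex].
    exists (ex_RInt_Reals_0 _ _ _ ex). now rewrite <- RInt_Reals.
Qed.

Lemma improper_integral_ext (f h : R -> R) (l : R) :
  (forall x, f x = h x) -> improper_integral f l -> improper_integral h l.
Proof.
  intros E. now replace h with f by (apply functional_extensionality; exact E).
Qed.

Lemma improper_integral_le (f h : R -> R) (lf lh : R) :
  (forall x, f x <= h x) ->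
  improper_integral f lf -> improper_integral h lh -> lf <= lh.
Proof.
  intros Hle Hf Hh. apply Rnot_lt_le; intros Hlt.
  (* On one window large enough for both, each integral is within half the gap of its limit, against
     the order of the integrals. *)
  destruct (proj1 (improper_integralE _ _) Hf ((lf - lh) / 2)) as [N1 [HN1 H1]]; [lra|].
  destruct (proj1 (improper_integralE _ _) Hh ((lf - lh) / 2)) as [N2 [HN2 H2]]; [lra|].
  pose proof (Rmax_l N1 N2); pose proof (Rmax_r N1 N2).
  destruct (H1 (- Rmax N1 N2) (Rmax N1 N2)) as [e1 I1]; try lra.
  destruct (H2 (- Rmax N1 N2) (Rmax N1 N2)) as [e2 I2]; try lra.
  assert (RInt f (- Rmax N1 N2) (Rmax N1 N2) <= RInt h (- Rmax N1 N2) (Rmax N1 N2)).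
  { apply RInt_le; auto; lra. }
  apply Rabs_def2 in I1; apply Rabs_def2 in I2; lra.
Qed.

Lemma ex_RInt_lin (f h : R -> R) (c d a b : R) :
  ex_RInt f a b -> ex_RInt h a b -> ex_RInt (fun x => c * f x + d * h x) a b.
Proof.
  intros Hf Hh.
  apply (ex_RInt_plus (V := R_NormedModule) (fun x => c * f x) (fun x => d * h x));
    now apply (ex_RInt_scal (V := R_NormedModule)).
Qed.

Lemma RInt_lin (f h : R -> R) (c d a b : R) :
  ex_RInt f a b -> ex_RInt h a b ->
  RInt (fun x => c * f x + d * h x) a b = c * RInt f a b + d * RInt h a b.
Proof.
  intros Hf Hh.
  pose proof (RInt_scal (V := R_CompleteNormedModule) f a b c Hf) as Ef.
  pose proof (RInt_scal (V := R_CompleteNormedModule) h a b d Hh) as Eh.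
  unfold scal in Ef, Eh; simpl in Ef, Eh; unfold mult in Ef, Eh; simpl in Ef, Eh.
  rewrite <- Ef, <- Eh.
  apply (RInt_plus (V := R_CompleteNormedModule) (fun x => c * f x) (fun x => d * h x));
    now apply (ex_RInt_scal (V := R_NormedModule)).
Qed.

Lemma improper_integral_lin (f h : R -> R) (lf lh c d : R) :
  improper_integral f lf -> improper_integral h lh ->
  improper_integral (fun x => c * f x + d * h x) (c * lf + d * lh).
Proof.
  intros Hf Hh. apply improper_integralE; intros eps Heps.
  pose proof (Rabs_pos c) as Hc; pose proof (Rabs_pos d) as Hd.
  (* The [+ 1] keeps [k] positive when [c = d = 0] and makes the final bound strict. *)
  set (k := Rabs c + Rabs d + 1).
  assert (Hk : 0 < k) by (unfold k; lra).
  assert (He : 0 < eps / k) by now apply Rdiv_lt_0_compat.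
  destruct (proj1 (improper_integralE _ _) Hf _ He) as [N1 [HN1 H1]].
  destruct (proj1 (improper_integralE _ _) Hh _ He) as [N2 [HN2 H2]].
  pose proof (Rmax_l N1 N2); pose proof (Rmax_r N1 N2).
  exists (Rmax N1 N2); split; [lra|]. intros a b Ha Hb.
  destruct (H1 a b) as [e1 I1]; try lra.
  destruct (H2 a b) as [e2 I2]; try lra.
  split; [now apply ex_RInt_lin|].
  rewrite RInt_lin; auto.
  replace (c * RInt f a b + d * RInt h a b - (c * lf + d * lh))
    with (c * (RInt f a b - lf) + d * (RInt h a b - lh)) by ring.
  eapply Rle_lt_trans; [apply Rabs_triang|]. rewrite !Rabs_mult.
  assert (Rabs c * Rabs (RInt f a b - lf) <= Rabs c * (eps / k))
    by (apply Rmult_le_compat_l; lra).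
  assert (Rabs d * Rabs (RInt h a b - lh) <= Rabs d * (eps / k))
    by (apply Rmult_le_compat_l; lra).
  assert (k * (eps / k) = eps) by (field; lra).
  unfold k in *. lra.
Qed.

Lemma RInt_le_widen (f : R -> R) (a b a' b' : R) :
  (forall x, 0 <= f x) -> (forall x y, ex_RInt f x y) ->
  a' <= a -> a <= b -> b <= b' -> RInt f a b <= RInt f a' b'.
Proof.
  intros Hpos Hex Ha Hab Hb.
  pose proof (RInt_Chasles (V := R_CompleteNormedModule) f a' a b' (Hex _ _) (Hex _ _)) as E1.
  pose proof (RInt_Chasles (V := R_CompleteNormedModule) f a b b' (Hex _ _) (Hex _ _)) as E2.
  unfold plus in E1, E2; simpl in E1, E2.
  assert (0 <= RInt f a' a) by (apply RInt_ge_0; auto).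
  assert (0 <= RInt f b b') by (apply RInt_ge_0; auto).
  lra.
Qed.

(** Integrals of a nonnegative function grow with the window, so they converge to their supremum. *)
Lemma improper_integral_bounded (f : R -> R) (K : R) :
  (forall x, 0 <= f x) -> (forall a b, ex_RInt f a b) ->
  (forall a b, a <= b -> RInt f a b <= K) ->
  exists l, improper_integral f l.
Proof.
  intros Hpos Hex HK.
  destruct (completeness (fun y => exists a b, a <= b /\ y = RInt f a b)) as [l [Hub Hlub]].
  - exists K. intros y [a [b [Hab ->]]]. auto.
  - exists (RInt f 0 0), 0, 0. split; [lra|reflexivity].
  - exists l. apply improper_integralE. intros eps Heps.
    assert (exists a b, a <= b /\ l - eps < RInt f a b) as [a0 [b0 [Hab0 H0]]].
    { apply NNPP. intros Hn.
      assert (l <= l - eps); [|lra]. apply Hlub. intros y [a [b [Hab ->]]].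
      apply Rnot_lt_le. intros Hlt. apply Hn. now exists a, b. }
    pose proof (Rmax_l (Rabs a0) (Rabs b0)); pose proof (Rmax_r (Rabs a0) (Rabs b0)).
    pose proof (Rabs_pos a0).
    pose proof (Rle_abs (- a0)) as Ha; rewrite Rabs_Ropp in Ha.
    pose proof (Rle_abs b0).
    (* Any window beyond this bound contains [[a0, b0]], whose integral is already within [eps] of
       the supremum. *)
    exists (Rmax (Rabs a0) (Rabs b0)). split; [lra|].
    intros a b Ha' Hb'. split; auto.
    assert (RInt f a0 b0 <= RInt f a b) by (apply RInt_le_widen; auto; lra).
    assert (RInt f a b <= l) by (apply Hub; exists a, b; split; [lra|reflexivity]).
    apply Rabs_def1; lra.
Qed.

Lemma ex_RInt_Rabs (f : R -> R) (a b : R) :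
  ex_RInt f a b -> ex_RInt (fun x => Rabs (f x)) a b.
Proof.
  intros H. apply ex_RInt_Reals_1.
  apply RiemannInt_P16. now apply ex_RInt_Reals_0.
Qed.

Lemma RInt_le_improper (f : R -> R) (l a b : R) :
  (forall x, 0 <= f x) -> (forall x y, ex_RInt f x y) ->
  improper_integral f l -> a <= b -> RInt f a b <= l.
Proof.
  intros Hpos Hex Hf Hab. apply Rnot_lt_le; intros Hlt.
  destruct (proj1 (improper_integralE _ _) Hf (RInt f a b - l)) as [N [HN H]]; [lra|].
  pose proof (Rmin_l a (- N)); pose proof (Rmin_r a (- N)).
  pose proof (Rmax_l b N); pose proof (Rmax_r b N).
  destruct (H (Rmin a (- N)) (Rmax b N)) as [_ I]; try lra.
  assert (RInt f a b <= RInt f (Rmin a (- N)) (Rmax b N))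
    by (apply RInt_le_widen; auto; lra).
  apply Rabs_def2 in I; lra.
Qed.

Lemma improper_integral_dominated (f h : R -> R) (l : R) :
  (forall a b, ex_RInt f a b) -> (forall a b, ex_RInt h a b) ->
  (forall x, Rabs (f x) <= h x) -> improper_integral h l ->
  exists l', improper_integral f l'.
Proof.
  assert (Hnn : forall f' h' l', (forall a b, ex_RInt f' a b) ->
    (forall a b, ex_RInt h' a b) -> (forall x, 0 <= f' x <= h' x) ->
    improper_integral h' l' -> exists l'', improper_integral f' l'').
  { intros f' h' l' Hf Hh Hle Hl.
    apply improper_integral_bounded with l'; auto; [apply Hle|].
    intros a b Hab. apply Rle_trans with (RInt h' a b).
    - apply RInt_le; auto. intros; apply Hle.
    - apply RInt_le_improper; auto.
      intros x; specialize (Hle x); lra. }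
  intros Hf Hh Hle Hl.
  assert (Hfa : forall a b, ex_RInt (fun x => Rabs (f x)) a b)
    by (intros; now apply ex_RInt_Rabs).
  destruct (Hnn (fun x => Rabs (f x)) h l) as [la Hla]; auto.
  { intros x; split; [apply Rabs_pos|apply Hle]. }
  (* [f] is the difference of [|f| + f] and [|f|], which are nonnegative and bounded by [2 * h] and
     [h]. The zero term only gives [2 * h] the shape of a linear combination. *)
  destruct (Hnn (fun x => 1 * Rabs (f x) + 1 * f x) (fun x => 2 * h x + 0 * h x)
              (2 * l + 0 * l)) as [ls Hls].
  - intros; now apply ex_RInt_lin.
  - intros; now apply ex_RInt_lin.
  - intros x. specialize (Hle x).
    pose proof (Rle_abs (f x)); pose proof (Rle_abs (- f x)) as Hm.
    rewrite Rabs_Ropp in Hm. lra.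
  - now apply improper_integral_lin.
  - exists (1 * ls + (-1) * la).
    eapply improper_integral_ext; [|exact (improper_integral_lin _ _ _ _ 1 (-1) Hls Hla)].
    intros x; simpl; ring.
Qed.

Lemma improper_integral_unique (f : R -> R) (l l' : R) :
  improper_integral f l -> improper_integral f l' -> l = l'.
Proof.
  intros H H'. apply Rle_antisym;
    eapply improper_integral_le; eauto; intros; lra.
Qed.

(** * Infima *)

Lemma is_inf_unique (S : R -> Prop) (m m' : R) : is_inf S m -> is_inf S m' -> m = m'.
Proof. intros [H1 H2] [H1' H2']. apply Rle_antisym; auto. Qed.

Lemma Rinf_eq (S : R -> Prop) (m : R) : is_inf S m -> Rinf S = m.
Proof.
  intros H. apply is_inf_unique with S; auto.
  apply (epsilon_spec (inhabits 0) (is_inf S)). now exists m.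
Qed.

(** The infimum is minus the supremum of the reflected set, so the choice operator in [Rinf] has
    something to choose. *)
Lemma Rinf_spec (S : R -> Prop) (K : R) :
  (exists y, S y) -> (forall y, S y -> K <= y) -> is_inf S (Rinf S).
Proof.
  intros [y0 Hy0] HK. apply (epsilon_spec (inhabits 0) (is_inf S)).
  destruct (completeness (fun y => S (- y))) as [l [Hub Hlub]].
  - exists (- K). intros y Hy. specialize (HK _ Hy). lra.
  - exists (- y0). now rewrite Ropp_involutive.
  - exists (- l). split.
    + intros y Hy. assert (- y <= l); [|lra]. apply Hub. now rewrite Ropp_involutive.
    + intros m' Hm'. assert (l <= - m'); [|lra]. apply Hlub.
      intros y Hy. specialize (Hm' _ Hy). lra.
Qed.

Lemma is_inf_approx (S : R -> Prop) (m eps : R) :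
  is_inf S m -> 0 < eps -> exists y, S y /\ y < m + eps.
Proof.
  intros [_ H] Heps. apply NNPP; intros Hn.
  assert (m + eps <= m); [|lra]. apply H. intros y Hy.
  apply Rnot_lt_le; intros Hlt. apply Hn. now exists y.
Qed.

(** Partial minimisation preserves convexity, argued with [eps]-approximate minimizers since
    attainment is not known. It serves both the level [u] in CVaR and the decision [x] in the
    Bellman equation. *)
Lemma is_inf_convex (A B C : R -> Prop) (a b c th : R) :
  is_inf A a -> is_inf B b -> is_inf C c -> 0 <= th <= 1 ->
  (forall x y, A x -> B y -> exists z, C z /\ z <= (1 - th) * x + th * y) ->
  c <= (1 - th) * a + th * b.
Proof.
  intros HA HB [HC _] Hth H. apply le_epsilon; intros eps Heps.
  destruct (is_inf_approx A a eps) as [x [Hx Hxa]]; auto.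
  destruct (is_inf_approx B b eps) as [y [Hy Hyb]]; auto.
  destruct (H x y Hx Hy) as [z [Hz Hle]]. specialize (HC z Hz).
  assert ((1 - th) * x <= (1 - th) * (a + eps)) by (apply Rmult_le_compat_l; lra).
  assert (th * y <= th * (b + eps)) by (apply Rmult_le_compat_l; lra).
  lra.
Qed.

(** * Convexity of the risk measure *)

(** The mass is some finite number, not necessarily one: for Gaussians finiteness follows by
    comparison, without evaluating the Gaussian integral. *)
Definition finite_density (dens : R -> R) : Prop :=
  (forall x, 0 <= dens x) /\ (forall a b, ex_RInt dens a b) /\
  exists m, improper_integral dens m.

Lemma integrable_wrtE (dens f : R -> R) :
  integrable_wrt dens f <->
  (forall a b, ex_RInt (fun x => f x * dens x) a b) /\
  exists l, improper_integral (fun x => Rabs (f x * dens x)) l.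
Proof.
  split; intros [H1 H2]; split; auto; intros a b.
  - destruct (H1 a b) as [pr]. now apply ex_RInt_Reals_1.
  - constructor. now apply ex_RInt_Reals_0.
Qed.

(** Absolute integrability dominates the integrand, so a limit exists and the choice operator in
    [expect] returns it. *)
Lemma expect_spec (dens f : R -> R) :
  integrable_wrt dens f ->
  improper_integral (fun x => f x * dens x) (expect dens f).
Proof.
  intros H. apply integrable_wrtE in H as [Hex [l Hl]].
  apply (epsilon_spec (inhabits 0)
           (fun l => improper_integral (fun x => f x * dens x) l)).
  apply improper_integral_dominated with (2 := fun a b => ex_RInt_Rabs _ a b (Hex a b)) (4 := Hl);
    auto; intros; lra.
Qed.

Lemma expect_le_lin (dens X Y Z : R -> R) (c d : R) :
  (forall x, 0 <= dens x) ->
  integrable_wrt dens X -> integrable_wrt dens Y -> integrable_wrt dens Z ->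
  (forall w, Z w <= c * X w + d * Y w) ->
  expect dens Z <= c * expect dens X + d * expect dens Y.
Proof.
  intros Hd HX HY HZ Hle.
  eapply improper_integral_le;
    [|apply expect_spec, HZ|apply improper_integral_lin; apply expect_spec; [exact HX|exact HY]].
  intros x; simpl.
  replace (c * (X x * dens x) + d * (Y x * dens x))
    with ((c * X x + d * Y x) * dens x) by ring.
  apply Rmult_le_compat_r; auto.
Qed.

Lemma integrable_excess (dens X : R -> R) (u : R) :
  finite_density dens -> integrable_wrt dens X ->
  integrable_wrt dens (fun w => Rmax (X w - u) 0).
Proof.
  intros [Hpos [Hex [m Hm]]] HX.
  apply integrable_wrtE in HX as [HXex [l Hl]].
  assert (He : forall a b, ex_RInt (fun x => Rmax (X x - u) 0 * dens x) a b).
  { intros a b.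
    (* The positive part is written as [(z + |z|) / 2], which reduces local integrability to that of
       [z] and [|z|]. *)
    replace (fun x => Rmax (X x - u) 0 * dens x)
      with (fun x => / 2 * (1 * (X x * dens x) + (- u) * dens x)
                     + / 2 * Rabs (1 * (X x * dens x) + (- u) * dens x)).
    - assert (ex_RInt (fun x => 1 * (X x * dens x) + (- u) * dens x) a b)
        by (apply ex_RInt_lin; auto).
      apply ex_RInt_lin; auto. now apply ex_RInt_Rabs.
    - apply functional_extensionality; intros x.
      replace (1 * (X x * dens x) + (- u) * dens x) with ((X x - u) * dens x) by ring.
      rewrite Rabs_mult, (Rabs_pos_eq (dens x)) by auto.
      unfold Rmax, Rabs. destruct (Rle_dec (X x - u) 0), (Rcase_abs (X x - u)); try lra.
      assert (X x - u = 0) as -> by lra. ring. }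
  apply integrable_wrtE. split; auto.
  (* The excess is at most [|X| + |u|], whose integral against the density is finite. *)
  eapply improper_integral_dominated;
    [| |intros x|exact (improper_integral_lin _ _ _ _ 1 (Rabs u) Hl Hm)].
  - intros; now apply ex_RInt_Rabs.
  - intros; apply ex_RInt_lin; auto. now apply ex_RInt_Rabs.
  - rewrite Rabs_Rabsolu, !Rabs_mult, (Rabs_pos_eq (dens x)) by auto.
    replace (1 * (Rabs (X x) * dens x) + Rabs u * dens x)
      with ((Rabs (X x) + Rabs u) * dens x) by ring.
    apply Rmult_le_compat_r; auto.
    rewrite Rabs_pos_eq by apply Rmax_r.
    pose proof (Rabs_pos (X x)); pose proof (Rabs_pos u).
    apply Rmax_lub; [|lra].
    pose proof (Rle_abs (X x)); pose proof (Rle_abs (- u)) as Hu.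
    rewrite Rabs_Ropp in Hu. lra.
Qed.

Definition CVaR_set (dens : R -> R) (alpha : R) (X : R -> R) : R -> Prop :=
  fun y => exists u, y = u + / (1 - alpha) * expect dens (fun w => Rmax (X w - u) 0).

(** The objective in [u] is nonnegative for [u >= 0]. For [u < 0] the excess is at least [X - u],
    and a mass of at least [1 - alpha] lets the terms in [u] cancel, leaving a bound free of [u]. *)
Lemma is_inf_CVaR (dens X : R -> R) (alpha m : R) :
  finite_density dens -> integrable_wrt dens X -> improper_integral dens m ->
  0 < alpha < 1 -> 1 - alpha <= m ->
  is_inf (CVaR_set dens alpha X) (CVaR dens alpha X).
Proof.
  intros Hd HX Hm Ha Hma.
  apply Rinf_spec with (Rmin 0 (/ (1 - alpha) * expect dens X)).
  - eexists. exists 0. reflexivity.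
  - intros y [u ->].
    assert (Hinv : 0 < / (1 - alpha)) by (apply Rinv_0_lt_compat; lra).
    assert (E : / (1 - alpha) * (1 - alpha) = 1) by (field; lra).
    pose proof (expect_spec _ _ (integrable_excess _ _ u Hd HX)) as HE.
    assert (H0 : 0 * m + 0 * m <= expect dens (fun w => Rmax (X w - u) 0)).
    { eapply improper_integral_le;
        [|exact (improper_integral_lin _ _ _ _ 0 0 Hm Hm)|exact HE].
      intros x; simpl.
      assert (0 <= Rmax (X x - u) 0 * dens x); [|lra].
      apply Rmult_le_pos; [apply Rmax_r|apply Hd]. }
    assert (H1 : 1 * expect dens X + (- u) * m <= expect dens (fun w => Rmax (X w - u) 0)).
    { eapply improper_integral_le;
        [|exact (improper_integral_lin _ _ _ _ 1 (- u) (expect_spec _ _ HX) Hm)|exact HE].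
      intros x; simpl.
      replace (1 * (X x * dens x) + - u * dens x) with ((X x - u) * dens x) by ring.
      apply Rmult_le_compat_r; [apply Hd|apply Rmax_l]. }
    set (e := expect dens (fun w => Rmax (X w - u) 0)) in *.
    destruct (Rle_dec 0 u) as [Hu|Hu].
    + apply Rle_trans with 0; [apply Rmin_l|].
      assert (0 <= / (1 - alpha) * e) by (apply Rmult_le_pos; lra). lra.
    + apply Rle_trans with (/ (1 - alpha) * expect dens X); [apply Rmin_r|].
      assert (/ (1 - alpha) * (expect dens X - u * (1 - alpha)) <= / (1 - alpha) * e).
      { apply Rmult_le_compat_l; [lra|].
        assert (- u * (1 - alpha) <= - u * m) by (apply Rmult_le_compat_l; lra). lra. }
      assert (/ (1 - alpha) * (expect dens X - u * (1 - alpha))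
              = / (1 - alpha) * expect dens X - u * (/ (1 - alpha) * (1 - alpha))) by ring.
      rewrite E in *. lra.
Qed.

(* A total mass below [1 - alpha] makes the defining infimum [-oo] for every
   integrable [X], and the choice operator then returns one and the same value. *)
Lemma CVaR_of_small_mass (dens X : R -> R) (alpha m : R) :
  finite_density dens -> integrable_wrt dens X -> improper_integral dens m ->
  0 < alpha < 1 -> m < 1 - alpha ->
  CVaR dens alpha X = epsilon (inhabits 0) (fun _ => False).
Proof.
  intros Hd HX Hm Ha Hma.
  unfold CVaR, Rinf. f_equal. apply functional_extensionality; intros k.
  apply propositional_extensionality; split; [|tauto]. intros [Hlb _].
  destruct (proj1 (integrable_wrtE _ _) HX) as [HXex [A HA]].
  assert (Hinv : 0 < / (1 - alpha)) by (apply Rinv_0_lt_compat; lra).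
  assert (E : / (1 - alpha) * (1 - alpha) = 1) by (field; lra).
  set (A' := / (1 - alpha) * A) in *.
  set (delta := / (1 - alpha) * (1 - alpha - m)).
  assert (Hdelta : 0 < delta) by (apply Rmult_lt_0_compat; lra).
  (* At [u = - v] the objective is at most [A' - v * delta]; this [v] takes it below the supposed
     lower bound [k]. *)
  set (v := (Rabs (A' - k) + 1) / delta).
  pose proof (Rabs_pos (A' - k)); pose proof (Rle_abs (A' - k)).
  assert (Hv : 0 < v) by (apply Rdiv_lt_0_compat; lra).
  assert (Ev : v * delta = Rabs (A' - k) + 1) by (unfold v; field; lra).
  pose proof (Hlb _ (ex_intro _ (- v) eq_refl)) as Hk.
  assert (H1 : expect dens (fun w => Rmax (X w - - v) 0) <= 1 * A + v * m).
  { eapply improper_integral_le;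
      [|exact (expect_spec _ _ (integrable_excess _ _ _ Hd HX))
       |exact (improper_integral_lin _ _ _ _ 1 v HA Hm)].
    intros x; simpl. assert (0 <= dens x) by apply Hd.
    rewrite Rabs_mult, (Rabs_pos_eq (dens x)) by auto.
    replace (1 * (Rabs (X x) * dens x) + v * dens x)
      with ((Rabs (X x) + v) * dens x) by ring.
    apply Rmult_le_compat_r; auto.
    pose proof (Rabs_pos (X x)); pose proof (Rle_abs (X x)).
    apply Rmax_lub; lra. }
  apply (Rmult_le_compat_l (/ (1 - alpha))) in H1; [|lra].
  assert (/ (1 - alpha) * (1 * A + v * m)
          = A' + v * (/ (1 - alpha) * (1 - alpha)) - v * delta)
    by (unfold A', delta; ring).
  rewrite E in *. lra.
Qed.

Lemma CVaR_convex (dens X Y Z : R -> R) (alpha th : R) :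
  finite_density dens -> 0 < alpha < 1 -> 0 <= th <= 1 ->
  integrable_wrt dens X -> integrable_wrt dens Y -> integrable_wrt dens Z ->
  (forall w, Z w <= (1 - th) * X w + th * Y w) ->
  CVaR dens alpha Z <= (1 - th) * CVaR dens alpha X + th * CVaR dens alpha Y.
Proof.
  intros Hd Ha Hth HX HY HZ Hle.
  destruct (Hd) as [Hpos [_ [m Hm]]].
  destruct (Rlt_dec m (1 - alpha)) as [Hma|Hma].
  (* All three values are the same default constant, so both sides agree. *)
  { rewrite !(CVaR_of_small_mass dens _ alpha m); auto. lra. }
  apply Rnot_lt_le in Hma.
  eapply is_inf_convex; try (eapply is_inf_CVaR; eauto); auto.
  intros x y [u ->] [v ->].
  (* The levels are combined with the same weights, because the positive part of [X - u] is jointly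
     convex in [X] and [u]. *)
  eexists. split; [exists ((1 - th) * u + th * v); reflexivity|].
  assert (H : expect dens (fun w => Rmax (Z w - ((1 - th) * u + th * v)) 0)
     <= (1 - th) * expect dens (fun w => Rmax (X w - u) 0)
        + th * expect dens (fun w => Rmax (Y w - v) 0)).
  { apply expect_le_lin; auto using integrable_excess.
    intros w. specialize (Hle w).
    pose proof (Rmax_l (X w - u) 0); pose proof (Rmax_r (X w - u) 0).
    pose proof (Rmax_l (Y w - v) 0); pose proof (Rmax_r (Y w - v) 0).
    assert ((1 - th) * (X w - u) <= (1 - th) * Rmax (X w - u) 0)
      by (apply Rmult_le_compat_l; lra).
    assert (th * (Y w - v) <= th * Rmax (Y w - v) 0)
      by (apply Rmult_le_compat_l; lra).
    assert (0 <= (1 - th) * Rmax (X w - u) 0) by (apply Rmult_le_pos; lra).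
    assert (0 <= th * Rmax (Y w - v) 0) by (apply Rmult_le_pos; lra).
    apply Rmax_lub; lra. }
  assert (Hinv : 0 < / (1 - alpha)) by (apply Rinv_0_lt_compat; lra).
  apply (Rmult_le_compat_l (/ (1 - alpha))) in H; lra.
Qed.

Lemma rho_convex (dens X Y Z : R -> R) (b : R * R) (th : R) :
  finite_density dens -> 0 <= fst b <= 1 -> 0 < snd b < 1 -> 0 <= th <= 1 ->
  integrable_wrt dens X -> integrable_wrt dens Y -> integrable_wrt dens Z ->
  (forall w, Z w <= (1 - th) * X w + th * Y w) ->
  rho dens b Z <= (1 - th) * rho dens b X + th * rho dens b Y.
Proof.
  intros Hd Hl Ha Hth HX HY HZ Hle. unfold rho.
  pose proof (CVaR_convex _ _ _ _ _ _ Hd Ha Hth HX HY HZ Hle) as HC.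
  pose proof (expect_le_lin _ _ _ _ _ _ (proj1 Hd) HX HY HZ Hle) as HE.
  apply (Rmult_le_compat_l (1 - fst b)) in HE; [|lra].
  apply (Rmult_le_compat_l (fst b)) in HC; [|lra].
  lra.
Qed.

(** * Finite mass of the Gaussian mixture *)

Lemma is_RInt_cauchy_kernel (m s a b : R) :
  s <> 0 ->
  is_RInt (fun x => / (1 + ((x - m) / s) ^ 2)) a b
    (s * atan ((b - m) / s) - s * atan ((a - m) / s)).
Proof.
  intros Hs.
  assert (Hp : forall x, 1 + ((x - m) / s) ^ 2 <> 0).
  { intros x. pose proof (pow2_ge_0 ((x - m) / s)). lra. }
  apply (is_RInt_derive (V := R_CompleteNormedModule) (fun x => s * atan ((x - m) / s))).
  - intros x _.
    evar_last.
    + apply is_derive_scal. apply (is_derive_comp atan (fun x => (x - m) / s)).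
      * apply is_derive_atan.
      * auto_derive; [auto|reflexivity].
    + unfold scal; simpl; unfold mult; simpl. unfold Rsqr.
      specialize (Hp x). field. split; auto.
      intros E. apply Hp. field_simplify; auto. unfold Rdiv in *.
      apply Rmult_eq_0_compat_r. rewrite <- E. ring.
  - intros x _. apply (ex_derive_continuous (V := R_NormedModule)).
    auto_derive. apply Hp.
Qed.

Lemma npdf_pos (m v x : R) : 0 < v -> 0 < npdf m v x.
Proof.
  intros Hv. apply Rdiv_lt_0_compat; [apply exp_pos|apply sqrt_lt_R0].
  pose proof PI_RGT_0. apply Rmult_lt_0_compat; lra.
Qed.

(** The Gaussian lies below a multiple of a Cauchy kernel, whose arctangent primitive bounds all
    window integrals at once. *)
Lemma finite_density_npdf (m v : R) : 0 < v -> finite_density (npdf m v).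
Proof.
  intros Hv.
  assert (Hc : 0 < sqrt (2 * PI * v)).
  { apply sqrt_lt_R0. pose proof PI_RGT_0. apply Rmult_lt_0_compat; lra. }
  assert (Hex : forall a b, ex_RInt (npdf m v) a b).
  { intros a b. apply (ex_RInt_continuous (V := R_CompleteNormedModule)). intros z _.
    apply (ex_derive_continuous (V := R_NormedModule)).
    unfold npdf. auto_derive. lra. }
  assert (Hpos : forall x, 0 <= npdf m v x) by (intros; left; now apply npdf_pos).
  split; [|split]; auto.
  (* With this scale the Gaussian exponent is minus the square in the Cauchy kernel. *)
  set (s := sqrt (2 * v)). assert (Hs : 0 < s) by (apply sqrt_lt_R0; lra).
  assert (Es : s ^ 2 = 2 * v) by (apply pow2_sqrt; lra).
  set (c := sqrt (2 * PI * v)) in *.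
  apply improper_integral_bounded with (/ c * (s * PI)); auto.
  intros a b Hab.
  assert (HI : is_RInt (fun x => / c * / (1 + ((x - m) / s) ^ 2)) a b
                 (/ c * (s * atan ((b - m) / s) - s * atan ((a - m) / s)))).
  { apply (is_RInt_scal (V := R_NormedModule)), is_RInt_cauchy_kernel. lra. }
  apply Rle_trans with (RInt (fun x => / c * / (1 + ((x - m) / s) ^ 2)) a b).
  - apply RInt_le; auto; [eexists; exact HI|]. intros x _.
    unfold npdf. fold c. unfold Rdiv at 1. rewrite Rmult_comm.
    apply Rmult_le_compat_l; [left; now apply Rinv_0_lt_compat|].
    (* [exp (- z) <= 1 / (1 + z)] *)
    assert (E : - (x - m) ^ 2 / (2 * v) = - ((x - m) / s) ^ 2).
    { rewrite <- Es. field. lra. }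
    rewrite E, exp_Ropp. apply Rinv_le_contravar.
    + pose proof (pow2_ge_0 ((x - m) / s)). lra.
    + apply exp_ineq1_le.
  - rewrite (is_RInt_unique _ _ _ _ HI).
    apply Rmult_le_compat_l; [left; now apply Rinv_0_lt_compat|].
    pose proof (atan_bound ((b - m) / s)); pose proof (atan_bound ((a - m) / s)).
    rewrite <- Rmult_minus_distr_l. apply Rmult_le_compat_l; lra.
Qed.

Lemma finite_density_lin (d1 d2 : R -> R) (a b : R) :
  0 <= a -> 0 <= b -> finite_density d1 -> finite_density d2 ->
  finite_density (fun x => a * d1 x + b * d2 x).
Proof.
  intros Ha Hb [H1 [E1 [m1 I1]]] [H2 [E2 [m2 I2]]]. split; [|split].
  - intros x. apply Rplus_le_le_0_compat; apply Rmult_le_pos; auto.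
  - intros; now apply ex_RInt_lin.
  - eexists. apply improper_integral_lin; eassumption.
Qed.

Lemma finite_density_psi (M : Model) (s : nat) :
  model_ok M -> finite_density (psi_dens M s).
Proof.
  intros (_ & _ & _ & _ & _ & _ & Hk & Hs & Hl & HJ & _).
  assert (Hv : 0 < xi_var M).
  { unfold xi_var. apply Rdiv_lt_0_compat; [|lra].
    apply Rmult_lt_0_compat; [now apply pow_lt|].
    assert (exp (-2 * kY M) < exp 0) by (apply exp_increasing; lra).
    rewrite exp_0 in *. lra. }
  assert (0 < sJ M ^ 2) by now apply pow_lt.
  apply finite_density_lin; try lra; apply finite_density_npdf; lra.
Qed.

(** * Convexity of the value functions *)

Definition convex_on (K : R) (f : R -> R) : Prop :=
  forall x y th, 0 <= x <= K -> 0 <= y <= K -> 0 <= th <= 1 ->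
    f ((1 - th) * x + th * y) <= (1 - th) * f x + th * f y.

Lemma convex_comb_in (a b x y th : R) :
  a <= x <= b -> a <= y <= b -> 0 <= th <= 1 -> a <= (1 - th) * x + th * y <= b.
Proof. intros. nra. Qed.

(* The midpoint is an average of [x] and its mirror image [K - x]. *)
Lemma convex_on_bounded_below (K : R) (f : R -> R) :
  0 <= K -> convex_on K f -> exists B, forall x, 0 <= x <= K -> B <= f x.
Proof.
  (* From [2 * f (K / 2) <= f x + f (K - x)], where [f (K - x)] is at most the larger endpoint
     value. *)
  intros HK Hf. exists (2 * f (K / 2) - Rmax (f 0) (f K)). intros x Hx.
  assert (H1 : f (K - x) <= Rmax (f 0) (f K)).
  { destruct (Req_dec K 0) as [->|Hne].
    - replace (0 - x) with 0 by lra. apply Rmax_l.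
    - assert (Hq : 0 <= (K - x) / K <= 1).
      { split; [apply Rle_div_r|apply Rle_div_l]; lra. }
      pose proof (Hf 0 K ((K - x) / K) ltac:(lra) ltac:(lra) Hq) as H.
      replace ((1 - (K - x) / K) * 0 + (K - x) / K * K) with (K - x) in H by (field; auto).
      pose proof (Rmax_l (f 0) (f K)); pose proof (Rmax_r (f 0) (f K)).
      eapply Rle_trans; [exact H|].
      assert ((1 - (K - x) / K) * f 0 <= (1 - (K - x) / K) * Rmax (f 0) (f K))
        by (apply Rmult_le_compat_l; lra).
      assert ((K - x) / K * f K <= (K - x) / K * Rmax (f 0) (f K))
        by (apply Rmult_le_compat_l; lra).
      lra. }
  pose proof (Hf x (K - x) (/ 2) Hx ltac:(lra) ltac:(lra)) as H2.
  replace ((1 - / 2) * x + / 2 * (K - x)) with (K / 2) in H2 by field.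
  lra.
Qed.

Lemma term_cost_convex (M : Model) (p w x y th : R) :
  model_ok M -> 0 <= th <= 1 ->
  term_cost M ((1 - th) * x + th * y) p w
  <= (1 - th) * term_cost M x p w + th * term_cost M y p w.
Proof.
  intros (_ & _ & _ & _ & Hp & Hg & _) Hth. unfold term_cost, hshort.
  set (H := Rmin _ _). set (G := gamY _ _).
  (* This is exactly the convexity gap: the shortage is affine in the charge and [G] is free of it,
     so only the term in the squared shortage contributes. *)
  assert (0 <= th * (1 - th) * gam_h M * pref M * (x - y) ^ 2); [|lra].
  apply Rmult_le_pos; [repeat apply Rmult_le_pos; lra|apply pow2_ge_0].
Qed.

(** Only an infimum is claimed: a convex [f] may jump at the ends of the interval, so convexity
    alone does not give attainment. *)
Lemma is_inf_bellman (M : Model) (f : R -> R) (r p : R) :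
  model_ok M -> convex_on (Rcap M) f -> 0 <= r <= Rcap M ->
  let S := fun y => exists x, Xadm M r x /\ y = x * p - cf M + f (r + x) in
  is_inf S (Rinf S).
Proof.
  intros (_ & HR & Hx & _) Hf Hr S.
  destruct (convex_on_bounded_below (Rcap M) f) as [B HB]; [lra|auto|].
  apply Rinf_spec with (- (xmax M * Rabs p) - cf M + B).
  - eexists. exists 0. split; [|reflexivity]. split; [lra|]. apply Rmin_glb; lra.
  - intros y [x [[Hx0 Hx1] ->]].
    pose proof (Rmin_l (Rcap M - r) (xmax M)); pose proof (Rmin_r (Rcap M - r) (xmax M)).
    specialize (HB (r + x) ltac:(lra)).
    pose proof (Rle_abs (- p)) as Hp; rewrite Rabs_Ropp in Hp; pose proof (Rabs_pos p).
    assert (x * - p <= x * Rabs p) by (apply Rmult_le_compat_l; lra).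
    assert (x * Rabs p <= xmax M * Rabs p) by (apply Rmult_le_compat_r; lra).
    lra.
Qed.

(** The pairs of charge and admissible decision form a convex set, on which the cost is jointly
    convex; the combined decision is therefore a valid competitor. *)
Lemma bellman_convex (M : Model) (f : R -> R) (p : R) :
  model_ok M -> convex_on (Rcap M) f ->
  convex_on (Rcap M)
    (fun r => Rinf (fun y => exists x, Xadm M r x /\ y = x * p - cf M + f (r + x))).
Proof.
  intros HM Hf r1 r2 th Hr1 Hr2 Hth.
  eapply is_inf_convex; try (apply is_inf_bellman; auto using convex_comb_in); auto.
  intros y1 y2 [x1 [[A1 B1] ->]] [x2 [[A2 B2] ->]].
  pose proof (Rmin_l (Rcap M - r1) (xmax M)); pose proof (Rmin_r (Rcap M - r1) (xmax M)).
  pose proof (Rmin_l (Rcap M - r2) (xmax M)); pose proof (Rmin_r (Rcap M - r2) (xmax M)).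
  eexists. split; [exists ((1 - th) * x1 + th * x2); split; [|reflexivity]|].
  - split; [nra|]. apply Rmin_glb; nra.
  - pose proof (Hf (r1 + x1) (r2 + x2) th ltac:(lra) ltac:(lra) Hth) as H'.
    replace ((1 - th) * r1 + th * r2 + ((1 - th) * x1 + th * x2))
      with ((1 - th) * (r1 + x1) + th * (r2 + x2)) by ring.
    lra.
Qed.

(** [Vn] counts periods to go while [V] is indexed by time; for [t < T] the count [T - t] is the
    successor of [T - (t + 1)]. *)
Lemma V_Bellman (M : Model) (beta : nat -> R * R) (t : nat) (r p : R) :
  (t < T M)%nat ->
  V M beta t r p =
  Rinf (fun y => exists x, Xadm M r x /\ y = x * p - cf M + Vtil M beta t (r + x) p).
Proof.
  intros Ht. unfold V, Vtil, V.
  replace (T M - t)%nat with (S (T M - (t + 1))) by lia. simpl.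
  now replace (T M - S (T M - (t + 1)))%nat with t by lia.
Qed.

(** The next price does not depend on the charge, so convexity holds for each realisation [w] and
    passes through the risk measure. *)
Lemma Vtil_convex_step (M : Model) (beta : nat -> R * R) (t s : nat) (p : R) :
  model_ok M -> beta_ok M beta -> well_posed M beta t -> (t <= s < T M)%nat ->
  (forall q, convex_on (Rcap M) (fun r => V M beta (s + 1) r q)) ->
  convex_on (Rcap M) (fun r => Vtil M beta s r p).
Proof.
  intros HM Hb [_ Hw] Hs HV x y th Hx Hy Hth.
  destruct (Hb s) as [Hl Ha]; [lia|].
  apply rho_convex; auto using finite_density_psi, convex_comb_in.
  intros w. now apply HV.
Qed.

Lemma V_convex (M : Model) (beta : nat -> R * R) (t n : nat) (p : R) :
  model_ok M -> beta_ok M beta -> well_posed M beta t -> (n <= T M - t)%nat ->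
  convex_on (Rcap M) (fun r => V M beta (T M - n) r p).
Proof.
  (* The price is generalised because the next value function is evaluated at every realised
     price. *)
  intros HM Hb Hw. revert p. induction n as [|n IH]; intros p Hn x y th Hx Hy Hth.
  - unfold V. replace (T M - (T M - 0))%nat with 0%nat by lia. simpl.
    destruct (Hb (T M)) as [Hl Ha]; [lia|]. destruct Hw as [Hw _].
    apply rho_convex; auto using finite_density_psi, convex_comb_in.
    intros w. now apply term_cost_convex.
  - destruct (Nat.le_gt_cases (T M) n) as [Hle|Hlt]; [lia|].
    rewrite !V_Bellman by lia.
    apply (bellman_convex M (fun r => Vtil M beta (T M - S n) r p) p); auto.
    apply Vtil_convex_step with t; auto; [lia|].
    intros q. replace (T M - S n + 1)%nat with (T M - n)%nat by lia.
    apply IH. lia.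
Qed.

Lemma Vtil_convex (M : Model) (beta : nat -> R * R) (t : nat) (p : R) :
  model_ok M -> beta_ok M beta -> (t < T M)%nat -> well_posed M beta t ->
  convex_on (Rcap M) (fun r => Vtil M beta t r p).
Proof.
  intros HM Hb Ht Hw. apply Vtil_convex_step with t; auto.
  intros q. replace (t + 1)%nat with (T M - (T M - (t + 1)))%nat by lia.
  apply V_convex with t; auto. lia.
Qed.

(** * Optimality of the threshold decision *)

(** As [x] lies between [m] and [y], [f x] is at most an average of [f m] and [f y], and
    [f m <= f y]. *)
Lemma convex_on_toward_minimizer (K : R) (f : R -> R) (m x y : R) :
  convex_on K f -> (forall z, 0 <= z <= K -> f m <= f z) -> 0 <= m <= K ->
  0 <= y <= K -> y <= x <= m \/ m <= x <= y -> f x <= f y.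
Proof.
  intros Hf Hm HmK Hy Hx.
  destruct (Req_dec m y) as [<-|Hne].
  { assert (x = m) as -> by lra. lra. }
  set (th := (x - m) / (y - m)).
  assert (Hth : 0 <= th <= 1).
  { unfold th. destruct Hx as [Hx|Hx].
    - replace ((x - m) / (y - m)) with ((m - x) / (m - y)) by (field; lra).
      split; [apply Rle_div_r|apply Rle_div_l]; lra.
    - split; [apply Rle_div_r|apply Rle_div_l]; lra. }
  pose proof (Hf m y th HmK Hy Hth) as H.
  replace ((1 - th) * m + th * y) with x in H by (unfold th; field; lra).
  assert ((1 - th) * f m <= (1 - th) * f y)
    by (apply Rmult_le_compat_l; [lra|apply Hm; lra]).
  lra.
Qed.

Theorem theorem2 (M : Model) (beta : nat -> R * R) (t : nat) (p rs : R) :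
  model_ok M -> beta_ok M beta -> (t < T M)%nat -> well_posed M beta t ->
  smallest_minimizer M beta t p rs ->
  forall r, 0 <= r <= Rcap M ->
    Xadm M r (xdec M rs r) /\
    (forall x, Xadm M r x ->
       xdec M rs r * p - cf M + Vtil M beta t (r + xdec M rs r) p
       <= x * p - cf M + Vtil M beta t (r + x) p) /\
    V M beta t r p = xdec M rs r * p - cf M + Vtil M beta t (r + xdec M rs r) p.
Proof.
  intros HM Hb Ht Hw [Hrs [Hmin _]] r Hr.
  pose proof (Vtil_convex M beta t p HM Hb Ht Hw) as Hc.
  (* The cost of [x] is [f (r + x)] up to the constant [- r * p - cf M], so decisions compare as
     post-decision levels do under [f]. *)
  set (f := fun r' => r' * p + Vtil M beta t r' p).
  assert (Hf : convex_on (Rcap M) f).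
  { intros x y th Hx Hy Hth. pose proof (Hc x y th Hx Hy Hth) as H. unfold f; simpl in H. lra. }
  pose proof (Rmin_l (Rcap M - r) (xmax M)) as Hl.
  pose proof (Rmin_r (Rcap M - r) (xmax M)) as Hu.
  assert (Hx0 : 0 < xmax M) by apply HM.
  assert (Hadm : Xadm M r (xdec M rs r)).
  { unfold xdec. destruct (Rle_dec r rs) as [Hle|Hgt]; split;
      try apply Rmin_glb; try lra.
    - apply Rle_trans with (rs - r); [apply Rmin_l|lra].
    - apply Rmin_r. }
  assert (Hopt : forall x, Xadm M r x ->
       xdec M rs r * p - cf M + Vtil M beta t (r + xdec M rs r) p
       <= x * p - cf M + Vtil M beta t (r + x) p).
  { intros x [Hx1 Hx2].
    assert (H : f (r + xdec M rs r) <= f (r + x)); [|unfold f in H; lra].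
    (* Either [rs] is reachable and is reached, or [r] is above it and not charging stays closest,
       or it is out of reach and charging [xmax] comes closest. *)
    destruct (Rle_dec rs (r + xmax M)) as [Hnear|Hfar].
    - destruct (Rle_dec r rs) as [Hle|Hgt].
      + replace (r + xdec M rs r) with rs; [apply Hmin; lra|].
        unfold xdec. destruct (Rle_dec r rs); [|lra]. rewrite Rmin_left; lra.
      + apply convex_on_toward_minimizer with (Rcap M) rs; auto; try lra.
        unfold xdec. destruct (Rle_dec r rs); lra.
    - apply convex_on_toward_minimizer with (Rcap M) rs; auto; try lra.
      unfold xdec. destruct (Rle_dec r rs); [|lra]. rewrite Rmin_right; lra. }
  split; [exact Hadm|split; [exact Hopt|]].
  (* A lower bound that is itself attained is the infimum. *)
  rewrite V_Bellman by assumption. apply Rinf_eq. split.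
  - intros y [x [Hx ->]]. now apply Hopt.
  - intros m' Hm'. apply Hm'. now exists (xdec M rs r).
Qed.
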